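(* Let $\Omega\subset\mathbb{R}^d$ be a compact set with a probability measure $\mu$. Suppose that a real system $\{u_i\}_{i=1}^N$ of functions on $\Omega$, orthonormal in $L_2(\Omega,\mu)$, with linear span $X_N:=\operatorname{span}(u_1,\dots,u_N)$, satisfies the following conditions. (A) There exist $\alpha>0$, $\beta$, and $K_1$ such that for all $i\in[1,N]$ we have $|u_i(\mathbf{x})-u_i(\mathbf{y})|\le K_1N^{\beta}\|\mathbf{x}-\mathbf{y}\|_\infty^{\alpha}$ for all $\mathbf{x},\mathbf{y}\in\Omega$. (B) There exists a constant $K_2$ such that $\|u_i\|_\infty^2\le K_2$, $i=1,\dots,N$. (C) There exist two constants $K_3$ and $K_4$ such that $\|f\|_\infty\le K_3N^{K_4/p}\|f\|_p$ for all $f\in X_N$ and all $p\in[2,\infty)$. Then there exists a set of $m\le C_1N(\log N)^{7/2}$ points $\xi^j\in\Omega$, $j=1,\dots,m$, with a constant $C_1=C(d,K_1,K_2,K_3,K_4,\Omega,\alpha,\beta)$ depending only on the listed quantities, such that for any $f\in X_N$ we have $$\frac12\|f\|_1\le\frac1m\sum_{j=1}^m|f(\xi^j)|\le\frac32\|f\|_1 .$$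
   Context: For $1\le p<\infty$, $\|f\|_p=(\int_\Omega|f|^p\,d\mu)^{1/p}$; $\|f\|_\infty=\sup_{\mathbf{x}\in\Omega}|f(\mathbf{x})|$ for functions on $\Omega$. For $\mathbf{x}\in\mathbb{R}^d$, $\|\mathbf{x}\|_\infty=\max_j|x_j|$. *)

(* Defs.v *)
From HB Require Import structures.
From mathcomp Require Import all_boot all_order all_algebra.
From mathcomp Require Import all_classical all_reals all_analysis.

Set Implicit Arguments.
Unset Strict Implicit.
Unset Printing Implicit Defensive.

Import Order.TTheory GRing.Theory Num.Theory.
Import numFieldNormedType.Exports.

Local Open Scope classical_set_scope.
Local Open Scope ring_scope.

(* R^d with its Borel sigma-algebra. The library norm `|x| on 'rV[R]_d is
   max_j |x_j| (mx_norm), and its topology is the usual one. *)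
Notation borel_rV R d := (g_sigma_algebraType (@open 'rV[R]_d)).

(* A function on Omega is represented by a function on R^d of which only the
   values on Omega matter; a probability measure on Omega is represented by a
   Borel probability measure mu on R^d such that mu Omega = 1. *)
Section functions_on_a_set.
Context (R : realType) (d : nat).
Implicit Types (mu : probability (borel_rV R d) R) (Omega : set 'rV[R]_d).
Implicit Types f : 'rV[R]_d -> R.

(* The restriction f \_ Omega is f on Omega and 0 elsewhere, so this is
   (\int_Omega |f|^p dmu)^(1/p). *)
Definition lpnorm mu Omega (p : R) f : \bar R :=
  'N[mu]_(p%:E)[EFin \o (f \_ Omega)].

(* The true supremum over Omega, not the mu-essential one. *)
Definition supnorm Omega f : \bar R :=
  ereal_sup [set `|f x|%:E | x in Omega].

Definition orthonormal_system mu Omega N (u : 'I_N -> 'rV[R]_d -> R) : Prop :=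
  (forall i, measurable_fun (Omega : set (borel_rV R d)) (u i)) /\
  (forall i j,
     \int[mu]_(x in Omega) (u i x * u j x)%:E = ((i == j)%:R : R)%:E)%E.

Definition span_on Omega N (u : 'I_N -> 'rV[R]_d -> R) : set ('rV[R]_d -> R) :=
  [set f | exists c : 'I_N -> R,
     forall x, Omega x -> f x = \sum_(i < N) c i * u i x].

End functions_on_a_set.

(* Main.v *)
(* The points are sampled independently from [mu]. Since only absolute values
   of elements of the span enter, symmetrization and the contraction principle
   reduce the uniform deviation to sup_{||f||_1 <= 1} |sum_j eps_j f(xi_j)|,
   which by duality is at most max_s |sum_j eps_j Z(xi_j, s)|, where
   Z(t, s) = sum_i u_i(t) u_i(s) is the reproducing kernel of the span. By (B),
   |Z| <= K2 N and E Z(xi, s)^2 <= K2 N, so an exponential moment bound and a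
   union bound over s in a grid of polynomial size (available by (A)) show that
   a constant times N log N points suffice; as N >= 2, this is at most
   a constant times N (log N)^(7/2).

   To keep the probability space finite, [mu] is first replaced by a weight [w]
   on the cells of that grid, with respect to which the system is only
   approximately orthonormal. *)
Require Import Defs.
From HB Require Import structures.
From mathcomp Require Import all_boot all_order all_algebra.
From mathcomp Require Import all_classical all_reals all_analysis.
From mathcomp Require Import measurable_realfun.
From mathcomp Require Import ring lra.

Import Order.TTheory GRing.Theory Num.Theory.
Import numFieldNormedType.Exports.

Local Open Scope classical_set_scope.
Local Open Scope ring_scope.

(** From e^x (1 - x) <= e^x e^(-x) = 1 and (1 + x + 2 x^2)(1 - x) = 1 + x^2 (1 - 2 x) >= 1. *)
Lemma expR_le_quadratic (R : realType) (x : R) :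
  x <= 1 / 2 -> expR x <= 1 + x + 2 * x ^+ 2.
Proof.
move=> hx.
have h1 : 0 < 1 - x by lra.
have h2 : expR x * (1 - x) <= 1.
  rewrite -[X in _ <= X](expRxMexpNx_1 x) ler_wpM2l ?expR_ge0 //.
  exact: expR_ge1Dx.
rewrite -(ler_pM2r h1); apply: (le_trans h2).
have := sqr_ge0 x; nra.
Qed.

(** * Symmetrization and contraction *)

Notation signs m := {ffun 'I_m -> bool}.

Definition flip_sign {m} (k : 'I_m) (e : signs m) : signs m :=
  [ffun j => (j == k) (+) e j].

Lemma flip_signK {m} (k : 'I_m) : involutive (flip_sign k).
Proof. by move=> e; apply/ffunP => j; rewrite !ffunE addbA addbb. Qed.

(* Suprema over the index set [S] are replaced by selections [F] of an index
   depending on the random signs (later: on the random points), so that nothing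
   has to be known about the existence of the suprema. Given the signs off
   coordinate [k], the two selected indices are exchanged when this turns
   [|q f k - q g k|] into [q f k - q g k]. *)
Lemma contraction_step (R : realType) (m : nat) (S : Type)
    (p q : S -> 'I_m -> R) (k : 'I_m) (F : signs m -> S) :
  (forall f j, j != k -> p f j = q f j) ->
  (forall f g, `|p f k - p g k| <= `|q f k - q g k|) ->
  exists F' : signs m -> S,
    \sum_(e : signs m) \sum_(j < m) (-1) ^+ e j * p (F e) j
      <= \sum_(e : signs m) \sum_(j < m) (-1) ^+ e j * q (F' e) j.
Proof.
move=> pq hk.
pose d (e : signs m) := (-1) ^+ e k * (q (F e) k - q (F (flip_sign k e)) k).
pose F' (e : signs m) := if 0 <= d e then F e else F (flip_sign k e).
exists F'.
have dflip e : d (flip_sign k e) = d e.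
  by rewrite /d flip_signK ffunE eqxx /= signrN mulNr -mulrN opprB.
(* Each [e] is paired with its flip. Off coordinate [k] the two sides agree on a pair, so only the
   inequality at [k] remains. *)
have sym (H : signs m -> R) :
    \sum_e H e *+ 2 = \sum_e (H e + H (flip_sign k e)).
  under eq_bigr do rewrite mulr2n.
  rewrite !big_split /=; congr (_ + _).
  by rewrite (reindex_inj (can_inj (flip_signK k))).
rewrite -(ler_pMn2r (n := 2)) // -!sumrMnl !sym; apply: ler_sum => e _.
rewrite [X in X + _](bigD1 k) //= [X in _ + X](bigD1 k) //=.
rewrite [X in _ <= X + _](bigD1 k) //= [X in _ <= _ + X](bigD1 k) //=.
have off f g : \sum_(i < m | i != k) (-1) ^+ e i * p f i +
     \sum_(i < m | i != k) (-1) ^+ flip_sign k e i * p g i =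
   \sum_(i < m | i != k) (-1) ^+ e i * q f i +
     \sum_(i < m | i != k) (-1) ^+ e i * q g i.
  by congr (_ + _); apply: eq_bigr => i ik; rewrite ?ffunE ?(negbTE ik) /= pq.
have off' f : \sum_(i < m | i != k) (-1) ^+ flip_sign k e i * q f i =
     \sum_(i < m | i != k) (-1) ^+ e i * q f i.
  by apply: eq_bigr => i ik; rewrite ?ffunE ?(negbTE ik).
have := off (F e) (F (flip_sign k e)).
have -> : flip_sign k e k = ~~ e k by rewrite ffunE eqxx.
rewrite !off' signrN.
have hkk := hk (F e) (F (flip_sign k e)).
rewrite /F' dflip flip_signK.
have dE : d e = (-1) ^+ e k * (q (F e) k - q (F (flip_sign k e)) k) by [].
have : (-1) ^+ e k * (p (F e) k - p (F (flip_sign k e)) k) <= `|d e|.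
  rewrite dE normrM normr_sign mul1r; apply: le_trans hkk.
  by rewrite (le_trans (ler_norm _)) // normrM normr_sign mul1r.
case: (lerP 0 (d e)) => hd.
  by rewrite (ger0_norm hd) dE; lra.
by rewrite (ltr0_norm hd) dE; lra.
Qed.

(** Absolute values are introduced one coordinate at a time, each step using that they are
    1-Lipschitz. Because the outer absolute value is taken after summing over the signs, no factor 2
    is lost. *)
Lemma contraction (R : realType) (m : nat) (S : Type) (v : S -> 'I_m -> R)
    (M : signs m -> R) (F : signs m -> S) :
  (forall (e : signs m) f, \sum_(j < m) (-1) ^+ e j * v f j <= M e) ->
  `|\sum_(e : signs m) \sum_(j < m) (-1) ^+ e j * `|v (F e) j| | <= \sum_e M e.
Proof.
move=> hM.
pose p k f (j : 'I_m) := if (j < k)%N then `|v f j| else v f j.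
have step k (G : signs m -> S) : (k <= m)%N ->
    \sum_(e : signs m) \sum_(j < m) (-1) ^+ e j * p k (G e) j <= \sum_e M e.
  elim: k G => [|k IH] G km; first by apply: ler_sum => e _; exact: hM.
  have [||G' hG'] := @contraction_step R m S (p k.+1) (p k) (Ordinal km) G.
  - move=> f j; rewrite -val_eqE /= /p ltnS leq_eqVlt => /negbTE -> //.
  - by move=> f g; rewrite /p /= ltnS leqnn ltnn ler_dist_dist.
  by apply: le_trans hG' _; apply: IH; exact: ltnW.
have bound (G : signs m -> S) :
    \sum_(e : signs m) \sum_(j < m) (-1) ^+ e j * `|v (G e) j| <= \sum_e M e.
  have := step m G (leqnn m); congr (_ <= _).
  by apply: eq_bigr => e _; apply: eq_bigr => j _; rewrite /p ltn_ord.
(* Negating all signs reduces the lower bound to the upper bound for the selection [F \o neg]. *)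
rewrite ler_norml bound andbT lerNl.
pose neg (e : signs m) : signs m := [ffun j => ~~ e j].
have negK : involutive neg by move=> e; apply/ffunP => j; rewrite !ffunE negbK.
apply: le_trans (bound (F \o neg)).
rewrite [X in _ <= X](reindex_inj (can_inj negK)) -sumrN le_eqVlt.
apply/orP; left; apply/eqP; apply: eq_bigr => e _.
rewrite -sumrN; apply: eq_bigr => j _.
by rewrite /= negK ffunE signrN mulNr.
Qed.

(** The probability of the sample [xi] under [m] independent draws from [w]; expectations over
    samples are sums against it. *)
Definition prodw {R : realType} {T : finType} {m} (w : T -> R)
  (xi : {ffun 'I_m -> T}) : R := \prod_(j < m) w (xi j).

Lemma prodw_ge0 (R : realType) (T : finType) (m : nat) (w : T -> R)
    (xi : {ffun 'I_m -> T}) : (forall t, 0 <= w t) -> 0 <= prodw w xi.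
Proof. by move=> w0; apply: prodr_ge0. Qed.

(** Independence of the draws; total mass, marginals and exponential moments all follow from it. *)
Lemma sum_prodw_prod (R : realType) (T : finType) (m : nat) (w : T -> R)
    (g : 'I_m -> T -> R) :
  \sum_(xi : {ffun 'I_m -> T}) prodw w xi * \prod_j g j (xi j)
    = \prod_j \sum_t w t * g j t.
Proof.
rewrite bigA_distr_bigA; apply: eq_bigr => xi _.
by rewrite /prodw big_split.
Qed.

Lemma sum_prodw (R : realType) (T : finType) (m : nat) (w : T -> R) :
  \sum_t w t = 1 -> \sum_(xi : {ffun 'I_m -> T}) prodw w xi = 1.
Proof.
move=> w1; transitivity (\prod_(j < m) \sum_t w t * (fun=> 1 : R) t).
  by rewrite -sum_prodw_prod; apply: eq_bigr => xi _; rewrite big1 ?mulr1.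
by rewrite big1 // => j _; under eq_bigr do rewrite mulr1.
Qed.

Lemma prodw_marginal (R : realType) (T : finType) (m : nat) (w g : T -> R)
    (j : 'I_m) :
  \sum_t w t = 1 ->
  \sum_(xi : {ffun 'I_m -> T}) prodw w xi * g (xi j) = \sum_t w t * g t.
Proof.
move=> w1.
transitivity (\prod_(i < m) \sum_t w t * (if i == j then g t else 1)).
  rewrite -sum_prodw_prod; apply: eq_bigr => xi _; congr (_ * _).
  by rewrite (bigD1 j) //= eqxx big1 ?mulr1 // => i /negbTE ->.
rewrite (bigD1 j) //= eqxx [X in _ * X]big1 ?mulr1 // => i /negbTE ->.
by under eq_bigr do rewrite mulr1.
Qed.

Definition swap_samples {T : Type} {m} (e : signs m)
    (z : {ffun 'I_m -> T} * {ffun 'I_m -> T}) :=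
  ([ffun j => if e j then z.2 j else z.1 j] : {ffun 'I_m -> T},
   [ffun j => if e j then z.1 j else z.2 j] : {ffun 'I_m -> T}).

Lemma swap_samplesK (T : Type) m (e : signs m) :
  involutive (@swap_samples T m e).
Proof.
by move=> [x y]; rewrite /swap_samples /=; congr (_, _); apply/ffunP => j;
  rewrite !ffunE; case: (e j).
Qed.

(** Ghost-sample argument. The power [2 ^+ m] appears because signs are summed over rather than
    averaged; the factor 2 on the right counts the sample and its ghost. *)
Lemma symmetrization (R : realType) (T : finType) (m : nat) (w : T -> R)
    (S : Type) (h : S -> T -> R) (B : {ffun 'I_m -> T} -> R)
    (F : {ffun 'I_m -> T} -> S) :
  (forall t, 0 <= w t) -> \sum_t w t = 1 ->
  (forall (xi : {ffun 'I_m -> T}) (G : signs m -> S),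
     `|\sum_(e : signs m) \sum_(j < m) (-1) ^+ e j * h (G e) (xi j)| <= B xi) ->
  2 ^+ m * `|\sum_(xi : {ffun 'I_m -> T}) prodw w xi *
       (\sum_(j < m) h (F xi) (xi j) - m%:R * \sum_t w t * h (F xi) t)|
    <= 2 * \sum_(xi : {ffun 'I_m -> T}) prodw w xi * B xi.
Proof.
move=> w0 w1 hB.
pose D f (z : {ffun 'I_m -> T} * {ffun 'I_m -> T}) :=
  \sum_(j < m) (h f (z.1 j) - h f (z.2 j)).
pose P (z : {ffun 'I_m -> T} * {ffun 'I_m -> T}) := prodw w z.1 * prodw w z.2.
(* The selected index depends on [z.1] only, so averaging over the ghost sample [z.2] produces the
   exact mean. *)
have -> : \sum_(xi : {ffun 'I_m -> T}) prodw w xi *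
       (\sum_(j < m) h (F xi) (xi j) - m%:R * \sum_t w t * h (F xi) t) =
    \sum_z P z * D (F z.1) z.
  rewrite [RHS](eq_bigr (fun z => P (z.1, z.2) * D (F z.1) (z.1, z.2)));
    last by case.
  rewrite -(pair_bigA _ (fun x y => P (x, y) * D (F x) (x, y))) /=.
  apply: eq_bigr => xi _; rewrite /P /D /=.
  under [RHS]eq_bigr do rewrite -mulrA sumrB.
  rewrite -mulr_sumr; congr (_ * _).
  under [RHS]eq_bigr do rewrite mulrBr.
  rewrite sumrB -mulr_suml sum_prodw // mul1r; congr (_ - _).
  under [RHS]eq_bigr do rewrite mulr_sumr.
  rewrite exchange_big /=.
  under [RHS]eq_bigr do rewrite prodw_marginal //.
  by rewrite sumr_const card_ord mulr_natl.
have Psw e z : P (swap_samples e z) = P z.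
  rewrite /P /prodw -!big_split /=; apply: eq_bigr => j _.
  by rewrite !ffunE; case: (e j) => //; rewrite mulrC.
have Dsw e f z : D f (swap_samples e z) =
    \sum_(j < m) (-1) ^+ e j * (h f (z.1 j) - h f (z.2 j)).
  apply: eq_bigr => j _; rewrite !ffunE.
  by case: (e j); rewrite ?mul1r ?expr1 ?mulN1r ?opprB ?expr0 ?mul1r.
(* The law of the pair is invariant under swapping, so the same value is obtained for every [e] and
   may be averaged over [e]. *)
have Xe (e : signs m) : \sum_z P z * D (F z.1) z =
    \sum_z P z * D (F (swap_samples e z).1) (swap_samples e z).
  rewrite (reindex_inj (can_inj (@swap_samplesK T m e))) /=.
  by apply: eq_bigr => z _; rewrite Psw.
have card_signs : (2 ^+ m : R) = \sum_(e : signs m) 1.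
  by rewrite sumr_const card_ffun card_bool card_ord natrX.
rewrite -[X in X * `|_|]ger0_norm ?exprn_ge0 // -normrM card_signs mulr_suml.
under eq_bigr => e _ do rewrite mul1r (Xe e).
rewrite exchange_big /=.
have -> : 2 * \sum_(xi : {ffun 'I_m -> T}) prodw w xi * B xi =
    \sum_z P z * (B z.1 + B z.2).
  rewrite [RHS](eq_bigr (fun z => P (z.1, z.2) * (B z.1 + B z.2)));
    last by case.
  rewrite -(pair_bigA _ (fun x y => P (x, y) * (B x + B y))) /= /P /=.
  under [RHS]eq_bigr => x _.
    under eq_bigr => y _ do rewrite mulrDr mulrAC -[X in _ + X]mulrA.
    rewrite big_split /= -!mulr_sumr sum_prodw // mulr1.
    over.
  rewrite big_split /= -mulr_suml sum_prodw // mul1r; ring.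
apply: le_trans (ler_norm_sum _ _ _) _; apply: ler_sum => z _.
rewrite -mulr_sumr normrM ger0_norm ?mulr_ge0 ?prodw_ge0 //.
apply: ler_wpM2l; first by rewrite mulr_ge0 ?prodw_ge0.
under eq_bigr => e _.
  rewrite Dsw; under eq_bigr => j _ do rewrite mulrBr.
  rewrite sumrB; over.
rewrite sumrB /=; apply: le_trans (ler_normB _ _) _.
(* For a fixed pair, the index selected after swapping depends on the signs; hence the
   quantification over [G] in the hypothesis on [B]. *)
by apply: lerD; exact: (hB _ (fun e => F (swap_samples e z).1)).
Qed.

(** * Exponential moments *)

(** Summing over the two values of one sign cancels the linear terms: e^y + e^(-y) <= 2 (1 + 2 y^2).
    Independence then gives an m-th power, and 1 + x <= e^x finishes. *)
Lemma rademacher_moment (R : realType) (T : finType) (m : nat) (w z : T -> R)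
    (lam sigma : R) :
  (forall t, 0 <= w t) -> \sum_t w t = 1 ->
  (forall t, `|lam * z t| <= 1 / 2) -> \sum_t w t * z t ^+ 2 <= sigma ->
  \sum_(xi : {ffun 'I_m -> T}) prodw w xi *
     \sum_(e : signs m) expR (lam * \sum_(j < m) (-1) ^+ e j * z (xi j))
    <= 2 ^+ m * expR (2 * m%:R * lam ^+ 2 * sigma).
Proof.
move=> w0 w1 zb zs.
have step (xi : {ffun 'I_m -> T}) :
    \sum_(e : signs m) expR (lam * \sum_(j < m) (-1) ^+ e j * z (xi j)) <=
    \prod_(j < m) (2 * (1 + 2 * lam ^+ 2 * z (xi j) ^+ 2)).
  under eq_bigr => e _ do rewrite mulr_sumr expR_sum.
  rewrite -(bigA_distr_bigA (fun j (b : bool) => expR (lam * ((-1) ^+ b * z (xi j))))).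
  apply: ler_prod => j _; rewrite big_bool /= expr1 expr0 mul1r mulN1r.
  rewrite addr_ge0 ?expR_ge0 //=.
  have := zb (xi j); rewrite ler_norml => /andP[h1 h2].
  have e1 := expR_le_quadratic _ _ h2.
  have : lam * - z (xi j) <= 1 / 2 by rewrite mulrN; lra.
  move=> /expR_le_quadratic e2; apply: le_trans (lerD e2 e1) _.
  by rewrite le_eqVlt; apply/orP; left; apply/eqP; ring.
apply: (@le_trans _ _ (\sum_(xi : {ffun 'I_m -> T}) prodw w xi *
   \prod_(j < m) (2 * (1 + 2 * lam ^+ 2 * z (xi j) ^+ 2)))).
  by apply: ler_sum => xi _; rewrite ler_wpM2l ?prodw_ge0.
rewrite (sum_prodw_prod _ _ _ _ (fun _ t => 2 * (1 + 2 * lam ^+ 2 * z t ^+ 2))).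
rewrite prodr_const card_ord.
have -> : \sum_t w t * (2 * (1 + 2 * lam ^+ 2 * z t ^+ 2)) =
   2 * (1 + 2 * lam ^+ 2 * \sum_t w t * z t ^+ 2).
  rewrite (eq_bigr (fun t => 2 * w t + 4 * lam ^+ 2 * (w t * z t ^+ 2)));
    last by move=> t _; ring.
  by rewrite big_split /= -!mulr_sumr w1; ring.
have s0 : 0 <= \sum_t w t * z t ^+ 2.
  by apply: sumr_ge0 => t _; rewrite mulr_ge0 ?sqr_ge0.
have l0 := sqr_ge0 lam.
rewrite exprMn ler_wpM2l ?exprn_ge0 //.
have -> : 2 * m%:R * lam ^+ 2 * sigma = m%:R * (2 * lam ^+ 2 * sigma) by ring.
rewrite expRM_natl lerXn2r ?nnegrE ?expR_ge0 //; first by nra.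
apply: le_trans (expR_ge1Dx _).
by rewrite lerD2l ler_wpM2l // mulr_ge0.
Qed.

(* Log-sum-exp: [M] is [ln (\sum_s e^(lam Z_s) + e^(- lam Z_s)) / lam], and its
   mean is bounded by Jensen's inequality for [ln]. *)
Lemma rademacher_maximal (R : realType) (T I : finType) (m : nat) (w : T -> R)
    (z : I -> T -> R) (lam sigma : R) :
  (0 < #|I|)%N ->
  (forall t, 0 <= w t) -> \sum_t w t = 1 -> 0 < lam ->
  (forall s t, lam * `|z s t| <= 1 / 2) ->
  (forall s, \sum_t w t * z s t ^+ 2 <= sigma) ->
  exists M : {ffun 'I_m -> T} -> signs m -> R,
    (forall (xi : {ffun 'I_m -> T}) (e : signs m) s,
       `|\sum_(j < m) (-1) ^+ e j * z s (xi j)| <= M xi e) /\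
    \sum_(xi : {ffun 'I_m -> T}) prodw w xi * \sum_(e : signs m) M xi e
      <= 2 ^+ m * (lam^-1 * (ln (2 * #|I|%:R) + 2 * m%:R * lam ^+ 2 * sigma)).
Proof.
move=> I0 w0 w1 l0 zb zs.
pose Y s (xi : {ffun 'I_m -> T}) (e : signs m) :=
  \sum_(j < m) (-1) ^+ e j * z s (xi j).
pose X xi e := \sum_s (expR (lam * Y s xi e) + expR (- lam * Y s xi e)).
have Xs s xi e : expR (lam * `|Y s xi e|) <= X xi e.
  rewrite /X (bigD1 s) //= -[X in X <= _]addr0 lerD //; last first.
    by apply: sumr_ge0 => i _; rewrite addr_ge0 ?expR_ge0.
  case: (lerP 0 (Y s xi e)) => h.
    by rewrite (ger0_norm h) lerDl expR_ge0.
  by rewrite (ltr0_norm h) mulrN mulNr lerDr expR_ge0.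
have [s0 _] : exists s : I, s \in I by apply/card_gt0P.
have X0 xi e : 0 < X xi e by apply: lt_le_trans (Xs s0 xi e); exact: expR_gt0.
exists (fun xi e => lam^-1 * ln (X xi e)); split => [xi e s|].
  rewrite -(ler_pM2l l0) mulrA mulfV ?gt_eqF // mul1r.
  by rewrite -ler_expR lnK ?posrE //; exact: Xs.
(* Bounds the mean of [X], which consists of two exponential moments for each index. *)
set a := 2 * #|I|%:R * expR (2 * m%:R * lam ^+ 2 * sigma).
have a0 : 0 < a by rewrite !mulr_gt0 ?expR_gt0 ?ltr0n.
have lna : ln a = ln (2 * #|I|%:R) + 2 * m%:R * lam ^+ 2 * sigma.
  by rewrite /a [LHS]lnM ?expRK ?posrE ?mulr_gt0 ?expR_gt0 ?ltr0n.
(* The tangent to [ln] at [a]; taking means in it is the use of Jensen. *)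
have lnX xi e : ln (X xi e) <= ln a - 1 + a^-1 * X xi e.
  have -> : X xi e = a * (a^-1 * X xi e) by rewrite mulrA mulfV ?gt_eqF ?mul1r.
  have h : 0 < a^-1 * X xi e by rewrite mulr_gt0 ?invr_gt0.
  rewrite lnM ?posrE // [X in _ <= _ + X]mulrA mulVf ?gt_eqF // mul1r.
  have := @le_ln1Dx R (a^-1 * X xi e - 1).
  have -> : 1 + (a^-1 * X xi e - 1) = a^-1 * X xi e by ring.
  by move=> /(_ ltac:(lra)); lra.
have EX : \sum_(xi : {ffun 'I_m -> T}) prodw w xi * \sum_(e : signs m) X xi e
    <= 2 ^+ m * a.
  under eq_bigr => xi _ do rewrite exchange_big /= mulr_sumr.
  rewrite exchange_big /= /a.
  have -> : 2 ^+ m * (2 * #|I|%:R * expR (2 * m%:R * lam ^+ 2 * sigma)) =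
     \sum_(s : I) (2 ^+ m * expR (2 * m%:R * lam ^+ 2 * sigma) *+ 2).
    by rewrite sumr_const -mulr_natl -[_ *+ 2]mulr_natl; ring.
  apply: ler_sum => s _.
  under eq_bigr do rewrite big_split mulrDr.
  rewrite big_split /= mulr2n lerD //.
    by apply: rademacher_moment => // t; rewrite normrM gtr0_norm.
  have -> : lam ^+ 2 = (- lam) ^+ 2 by rewrite sqrrN.
  apply: rademacher_moment => // t.
  by rewrite mulNr normrN normrM gtr0_norm.
under eq_bigr do rewrite -mulr_sumr mulrCA.
rewrite -mulr_sumr mulrCA ler_pM2l ?invr_gt0 // -lna.
apply: (@le_trans _ _ (\sum_(xi : {ffun 'I_m -> T}) prodw w xi *
   \sum_(e : signs m) (ln a - 1 + a^-1 * X xi e))).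
  by apply: ler_sum => xi _; rewrite ler_wpM2l ?prodw_ge0 //; apply: ler_sum.
have cs (c : R) : \sum_(e : signs m) c = 2 ^+ m * c.
  by rewrite sumr_const card_ffun card_bool card_ord -natrX mulr_natl.
under eq_bigr do rewrite big_split /= cs -mulr_sumr mulrDr.
rewrite big_split /= -mulr_suml sum_prodw // mul1r.
under [X in _ + X]eq_bigr do rewrite mulrCA.
rewrite -mulr_sumr.
have : a^-1 * (\sum_(xi : {ffun 'I_m -> T}) prodw w xi *
   \sum_(e : signs m) X xi e) <= 2 ^+ m.
  by rewrite mulrC ler_pdivrMr // .
lra.
Qed.

(** By contradiction: if every sample had a bad index, selecting one for each sample would give a
    mean absolute deviation of at least [4 * b], whereas symmetrization and contraction keep it
    below. *)
Lemma uniform_deviation (R : realType) (T : finType) (m : nat) (w : T -> R)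
    (S : Type) (v : S -> T -> R) (f0 : S) (b : R)
    (M : {ffun 'I_m -> T} -> signs m -> R) :
  (forall t, 0 <= w t) -> \sum_t w t = 1 -> (forall t, v f0 t = 0) ->
  (forall (xi : {ffun 'I_m -> T}) (e : signs m) f,
     \sum_(j < m) (-1) ^+ e j * v f (xi j) <= M xi e) ->
  \sum_(xi : {ffun 'I_m -> T}) prodw w xi * \sum_(e : signs m) M xi e
    < 2 ^+ m * b ->
  exists xi : {ffun 'I_m -> T}, forall f,
    `|\sum_(j < m) `|v f (xi j)| - m%:R * \sum_t w t * `|v f t| | <= 4 * b.
Proof.
move=> w0 w1 v0 hM hb.
pose D f (xi : {ffun 'I_m -> T}) :=
  \sum_(j < m) `|v f (xi j)| - m%:R * \sum_t w t * `|v f t|.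
have D0 xi : D f0 xi = 0.
  rewrite /D big1 => [|j _]; last by rewrite v0 normr0.
  by rewrite big1 ?mulr0 ?subr0 // => t _; rewrite v0 normr0 mulr0.
have mean (F : {ffun 'I_m -> T} -> S) :
    `|\sum_(xi : {ffun 'I_m -> T}) prodw w xi * D (F xi) xi| < 2 * b.
  have := symmetrization _ _ _ w _ (fun f t => `|v f t|)
    (fun xi => \sum_(e : signs m) M xi e) F w0 w1.
  move=> /(_ (fun xi G => contraction R m S (fun f j => v f (xi j)) (M xi) G
    (hM xi))) hF.
  rewrite -(ltr_pM2l (x := 2 ^+ m)) ?exprn_gt0 //.
  by apply: le_lt_trans hF _; rewrite mulrCA ltr_pM2l.
apply: contrapT => /forallNP bad.
have /choice[F hF] : forall xi, exists f, 4 * b < `|D f xi|.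
  move=> xi; have /existsNP[f hf] := bad xi; exists f.
  by rewrite ltNge; exact/negP.
(* Symmetrization controls the mean of the signed deviation only. The selection is split by sign,
   with [f0], of zero deviation, as filler; each half contributes less than [2 * b]. *)
have sgn_split xi : `|D (F xi) xi| =
    D (if 0 <= D (F xi) xi then F xi else f0) xi -
    D (if 0 <= D (F xi) xi then f0 else F xi) xi.
  by case: ifP => h; rewrite D0 ?subr0 ?sub0r;
    [rewrite ger0_norm|rewrite ltr0_norm ?ltNge ?h].
have h1 := mean (fun xi => if 0 <= D (F xi) xi then F xi else f0).
have h2 := mean (fun xi => if 0 <= D (F xi) xi then f0 else F xi).
have : 4 * b <= \sum_(xi : {ffun 'I_m -> T}) prodw w xi * `|D (F xi) xi|.
  rewrite -[4 * b]mul1r -[X in X * _ <= _](sum_prodw _ _ m w w1) mulr_suml.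
  by apply: ler_sum => xi _; rewrite ler_wpM2l ?prodw_ge0 // (ltW (hF xi)).
under eq_bigr => xi _ do rewrite sgn_split mulrBr.
rewrite sumrB /=; move: h1 h2; rewrite !ltr_norml => /andP[_ h1] /andP[h2 _].
lra.
Qed.

(** * Sampling from a finite set *)

Section approximately_orthonormal.
Context {R : realType} {T : finType} {N : nat}.
Variables (w : T -> R) (u : 'I_N -> T -> R) (kap eta : R).
Hypotheses (w0 : forall t, 0 <= w t) (w1 : \sum_t w t = 1).
Hypothesis N0 : (0 < N)%N.
Hypothesis kap1 : 1 <= kap.
Hypothesis ub : forall i t, `|u i t| <= kap.
Hypothesis gram : forall i k, `|\sum_t w t * (u i t * u k t) - (i == k)%:R| <= eta.
(** Scaled so that the reproducing formula below has error at most 1/64. *)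
Hypothesis eta_small : 128 * N%:R ^+ 2 * kap ^+ 2 * eta <= 1.

Let f (c : 'I_N -> R) t := \sum_i c i * u i t.
Let W c := \sum_t w t * `|f c t|.

Let eta0 : 0 <= eta.
Proof. by apply: le_trans (gram (Ordinal N0) (Ordinal N0)). Qed.

Let N1 : 1 <= N%:R :> R.
Proof. by rewrite ler1n. Qed.

Let A := N%:R * kap ^+ 2.

Let A1 : 1 <= A.
Proof. by rewrite /A mulr_ege1 // exprn_ege1. Qed.

Let Neta : 128 * N%:R * eta <= 1.
Proof.
apply: le_trans eta_small.
have -> : 128 * N%:R ^+ 2 * kap ^+ 2 * eta = 128 * N%:R * eta * A.
  by rewrite /A; ring.
by rewrite -[leLHS]mulr1 ler_wpM2l // !mulr_ge0.
Qed.

(** Pairing with [u i] would return [c i] exactly for an orthonormal system; each Gram entry is off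
    by at most [eta]. *)
Let gram_sum (c : 'I_N -> R) i :
  `|c i - \sum_t w t * (f c t * u i t)| <= eta * \sum_k `|c k|.
Proof.
have -> : c i = \sum_k c k * (k == i)%:R.
  rewrite (bigD1 i) //= eqxx mulr1 big1 ?addr0 // => k /negbTE ->.
  by rewrite mulr0.
have -> : \sum_t w t * (f c t * u i t) =
    \sum_k c k * \sum_t w t * (u k t * u i t).
  under eq_bigr do rewrite mulr_suml mulr_sumr.
  rewrite exchange_big /=; apply: eq_bigr => k _; rewrite mulr_sumr.
  by apply: eq_bigr => t _; ring.
rewrite -sumrB mulr_sumr; apply: le_trans (ler_norm_sum _ _ _) _.
apply: ler_sum => k _; rewrite -mulrBr normrM mulrC distrC.
by rewrite ler_wpM2r.
Qed.

(** Each coefficient is nearly the pairing with [u i], which is at most [kap * W c]. Summing over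
    [i] leaves an error of at most 1/128 of the left side, absorbed by the factor 2. *)
Lemma coefficients_le_l1 (c : 'I_N -> R) :
  \sum_k `|c k| <= 2 * N%:R * kap * W c.
Proof.
set s := \sum_k `|c k|.
have s0 : 0 <= s by apply: sumr_ge0.
have ci i : `|c i| <= kap * W c + eta * s.
  have : `|\sum_t w t * (f c t * u i t)| <= kap * W c.
    apply: le_trans (ler_norm_sum _ _ _) _; rewrite mulr_sumr.
    apply: ler_sum => t _; rewrite !normrM ger0_norm // [leRHS]mulrCA.
    rewrite ler_wpM2l // mulrC ler_wpM2r //.
  have := gram_sum c i; have := ler_normD (c i - \sum_t w t * (f c t * u i t))
     (\sum_t w t * (f c t * u i t)).
  by rewrite subrK -/s; lra.
have : s <= N%:R * (kap * W c + eta * s).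
  rewrite -[X in X%:R]card_ord -sum1_card natr_sum mulr_suml.
  by apply: ler_sum => i _; rewrite mul1r.
have : 128 * N%:R * eta * s <= 1 * s by rewrite ler_wpM2r.
lra.
Qed.

Let Z (s t : T) := \sum_i u i s * u i t.

Let Z_bound s t : `|Z s t| <= A.
Proof.
apply: le_trans (ler_norm_sum _ _ _) _.
rewrite /A -[X in X%:R]card_ord -sum1_card natr_sum mulr_suml.
apply: ler_sum => i _; rewrite mul1r normrM expr2.
by apply: ler_pM => //; exact: ub.
Qed.

(** The coefficients of [Z s] are the [u i s], so exact orthonormality would give the sum of their
    squares, at most [A]; the factor 2 absorbs the Gram error. *)
Let Z_moment s : \sum_t w t * Z s t ^+ 2 <= 2 * A.
Proof.
have -> : \sum_t w t * Z s t ^+ 2 = \sum_i u i s * \sum_t w t * (f (u^~ s) t * u i t).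
  under eq_bigr do rewrite expr2 {2}/Z mulr_sumr mulr_sumr.
  rewrite exchange_big /=; apply: eq_bigr => i _; rewrite mulr_sumr.
  by apply: eq_bigr => t _; rewrite /f -/(Z s t); ring.
have su : \sum_k `|u k s| <= N%:R * kap.
  rewrite -[X in X%:R]card_ord -sum1_card natr_sum mulr_suml.
  by apply: ler_sum => i _; rewrite mul1r.
have : forall i, u i s * \sum_t w t * (f (u^~ s) t * u i t) <=
    kap * (kap + eta * (N%:R * kap)).
  move=> i; apply: le_trans (ler_norm _) _; rewrite normrM.
  apply: ler_pM => //.
  set y := \sum_t _.
  have := gram_sum (u^~ s) i; rewrite -/y distrC => h.
  have := ler_normD (y - u i s) (u i s); rewrite subrK => h'.
  have := ub i s.
  have : eta * \sum_k `|u k s| <= eta * (N%:R * kap) by rewrite ler_wpM2l.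
  lra.
move=> h; apply: le_trans (ler_sum _ (fun i _ => h i)) _.
rewrite sumr_const card_ord -[leLHS]mulr_natl /A.
have -> : N%:R * (kap * (kap + eta * (N%:R * kap))) =
  (N%:R * kap ^+ 2) * (1 + N%:R * eta) by ring.
have : 0 <= N%:R * kap ^+ 2 by rewrite mulr_ge0 ?sqr_ge0.
have := Neta; nra.
Qed.

(* [Z] is the reproducing kernel of the span, up to the Gram error [eta]. *)
Let reproducing (c : 'I_N -> R) s :
  W c <= 1 -> `|f c s - \sum_t w t * (f c t * Z s t)| <= 1 / 64.
Proof.
move=> Wc.
have -> : \sum_t w t * (f c t * Z s t) =
    \sum_i u i s * \sum_t w t * (f c t * u i t).
  under eq_bigr do rewrite mulr_sumr mulr_sumr.
  rewrite exchange_big /=; apply: eq_bigr => i _; rewrite mulr_sumr.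
  by apply: eq_bigr => t _; ring.
rewrite /f -sumrB; apply: le_trans (ler_norm_sum _ _ _) _.
have h i : `|c i * u i s - u i s * \sum_t w t * (f c t * u i t)| <=
    kap * (eta * (2 * N%:R * kap)).
  rewrite mulrC -mulrBr normrM; apply: ler_pM => //.
  apply: le_trans (gram_sum c i) _; rewrite ler_wpM2l //.
  apply: le_trans (coefficients_le_l1 c) _.
  by rewrite -[leRHS]mulr1 ler_wpM2l // !mulr_ge0 // (le_trans _ kap1).
apply: le_trans (ler_sum _ (fun i _ => h i)) _.
rewrite sumr_const card_ord -[leLHS]mulr_natl.
have := eta_small; nra.
Qed.

Let Z_sym s t : Z s t = Z t s.
Proof. by apply: eq_bigr => i _; rewrite mulrC. Qed.

Let Z_momentT t : \sum_s w s * Z s t ^+ 2 <= 2 * A.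
Proof. by under eq_bigr do rewrite Z_sym; exact: Z_moment. Qed.

(** Uniform deviation over the ball [W c <= 1] with [b = m / 16], then homogeneity. Three
    contributions of at most [m / 64] fit strictly below [b]: the logarithmic term, the variance
    term and the reproducing error. *)
Lemma equal_weight_sampling (m : nat) :
  (0 < m)%N -> 16384 * N%:R * kap ^+ 2 * ln (2 * #|T|%:R) <= m%:R ->
  exists xi : {ffun 'I_m -> T}, forall c,
    `|\sum_(j < m) `|f c (xi j)| - m%:R * W c| <= m%:R / 4 * W c.
Proof.
move=> m0 hm.
have A0 : 0 < A by apply: lt_le_trans A1.
have mR : 0 < m%:R :> R by rewrite ltr0n.
have T0 : (0 < #|T|)%N.
  rewrite lt0n; apply/negP => /eqP/card0_eq h.
  have := w1; rewrite big_pred0 => [/esym/eqP|t]; first by rewrite oner_eq0.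
  by have := h t; rewrite inE.
have A256 : 0 < 256 * A by rewrite mulr_gt0 ?ltr0n.
(* With this [lam] the variance term is exactly [m / 64], and 16384 = 256 * 64 brings the
   logarithmic term down to [m / 64]. *)
have lam0 : 0 < (256 * A)^-1 by rewrite invr_gt0.
have zb s t : (256 * A)^-1 * `|Z t s| <= 1 / 2.
  rewrite mulrC ler_pdivrMr //.
  by have := Z_bound t s; lra.
have [M [hM EM]] := rademacher_maximal R T T m w (fun s t => Z t s)
  (256 * A)^-1 (2 * A) T0 w0 w1 lam0 zb (fun s => Z_momentT s).
pose S := {c : 'I_N -> R | W c <= 1}.
have W0 : W (fun=> 0) <= 1.
  by rewrite /W big1 // => t _; rewrite /f big1 ?normr0 ?mulr0 // => i _; rewrite mul0r.
pose f0 : S := exist _ (fun=> 0) W0.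
have [|||xi hxi] := uniform_deviation R T m w S (fun c => f (sval c)) f0
  (m%:R / 16) (fun xi e => M xi e + m%:R / 64) w0 w1.
- by move=> t; rewrite /f big1 // => i _; rewrite mul0r.
- move=> xi e [c Wc] /=.
  (* Duality: [f c] is replaced by its integral against the kernel, at a cost of 1/64 per point. The
     signed sum then falls on [Z] alone, where [M] bounds it uniformly in [t]. *)
  apply: (@le_trans _ _ (\sum_(j < m) (-1) ^+ e j *
       (\sum_t w t * (f c t * Z (xi j) t)) + m%:R / 64)).
    rewrite -lerBlDl -sumrB; apply: le_trans (ler_norm _) _.
    apply: le_trans (ler_norm_sum _ _ _) _.
    have -> : m%:R / 64 = \sum_(j < m) (1 / 64) :> R.
      by rewrite sumr_const card_ord -[RHS]mulr_natl; ring.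
    apply: ler_sum => j _; rewrite -mulrBr normrM normr_sign [leLHS]mul1r.
    exact: reproducing.
  rewrite lerD2r.
  have -> : \sum_(j < m) (-1) ^+ e j * (\sum_t w t * (f c t * Z (xi j) t)) =
     \sum_t w t * (f c t * \sum_(j < m) (-1) ^+ e j * Z (xi j) t).
    under eq_bigr do rewrite mulr_sumr.
    rewrite exchange_big /=; apply: eq_bigr => t _; rewrite !mulr_sumr.
    by apply: eq_bigr => j _; ring.
  have M0 : 0 <= M xi e.
    by have /card_gt0P[t _] := T0; apply: le_trans (hM xi e t).
  apply: (@le_trans _ _ (\sum_t w t * `|f c t| * M xi e)).
    apply: ler_sum => t _; rewrite -mulrA ler_wpM2l //.
    by apply: le_trans (ler_norm _) _; rewrite normrM ler_wpM2l //.
  by rewrite -mulr_suml -[leRHS]mul1r ler_wpM2r.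
- have cs : \sum_(e : signs m) (m%:R / 64) = 2 ^+ m * (m%:R / 64) :> R.
    by rewrite sumr_const card_ffun card_bool card_ord -natrX [RHS]mulr_natl.
  under eq_bigr do rewrite big_split /= cs mulrDr.
  rewrite big_split /= -mulr_suml sum_prodw // mul1r.
  have E : (256 * A)^-1^-1 * (ln (2 * #|T|%:R) + 2 * m%:R * (256 * A)^-1 ^+ 2 * (2 * A))
      = 256 * A * ln (2 * #|T|%:R) + m%:R / 64.
    by field; rewrite gt_eqF.
  rewrite E in EM; apply: le_lt_trans (lerD EM (lexx _)) _.
  rewrite -mulrDr ltr_pM2l ?exprn_gt0 //.
  by move: hm; rewrite /A; lra.
exists xi => c.
have : 0 <= W c by apply: sumr_ge0 => t _; rewrite mulr_ge0.
rewrite le_eqVlt => /orP[/eqP Wc|Wc].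
  (* A vanishing weighted norm kills all coefficients, hence also the values at points of weight
     zero. *)
  have c0 i : c i = 0.
    have := coefficients_le_l1 c; rewrite -Wc mulr0 => h.
    apply/eqP; rewrite -normr_le0; apply: le_trans h.
    by rewrite (bigD1 i) //= lerDl sumr_ge0.
  have fc0 t : f c t = 0 by rewrite /f big1 // => i _; rewrite c0 mul0r.
  rewrite -Wc !mulr0 subr0 big1 ?normr0 // => j _.
  by rewrite fc0 normr0.
have fs t : f (fun i => (W c)^-1 * c i) t = (W c)^-1 * f c t.
  by rewrite /f mulr_sumr; apply: eq_bigr => i _; rewrite mulrA.
have nfs t : `|f (fun i => (W c)^-1 * c i) t| = (W c)^-1 * `|f c t|.
  by rewrite fs normrM gtr0_norm ?invr_gt0.
have WE : \sum_t w t * `|f (fun i => (W c)^-1 * c i) t| = (W c)^-1 * W c.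
  by rewrite /W mulr_sumr; apply: eq_bigr => t _; rewrite nfs mulrCA.
have Ws : W (fun i => (W c)^-1 * c i) <= 1.
  by rewrite /W WE mulVf ?gt_eqF.
have := hxi (exist (fun c : 'I_N -> R => W c <= 1) _ Ws); rewrite /= WE.
under eq_bigr do rewrite nfs.
rewrite -mulr_sumr mulrCA -mulrBr normrM gtr0_norm ?invr_gt0 //.
by rewrite mulrC ler_pdivrMr //; lra.
Qed.

End approximately_orthonormal.

(** * Discretization of the measure *)

Lemma bounded_on_integrable (d : measure_display) (X : measurableType d)
    (R : realType) (mu : {finite_measure set X -> \bar R}) (D : set X)
    (g : X -> R) (M : R) :
  measurable D -> measurable_fun D g -> (forall x, D x -> `|g x| <= M) ->
  mu.-integrable D (EFin \o g).
Proof.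
move=> mD mg gM; apply: measurable_bounded_integrable => //.
  by rewrite ltey_eq fin_num_measure.
exists M; split; first exact: num_real.
by move=> K MK x /= Dx; apply: le_trans (gM x Dx) (ltW MK).
Qed.

(** On each cell, replacing [g] by a constant costs at most [eta] times the mass of the cell, and
    the masses add up to 1. *)
Lemma Rintegral_quantization (d : measure_display) (X : measurableType d)
    (R : realType) (mu : probability X R) (D : set X) (I : finType)
    (c : X -> I) (g : X -> R) (y : I -> R) (eta : R) :
  measurable D -> (forall t, measurable (D `&` c @^-1` [set t])) ->
  mu D = 1%E -> measurable_fun D g ->
  (forall x, D x -> `|g x - y (c x)| <= eta) ->
  `|\int[mu]_(x in D) g x - \sum_t fine (mu (D `&` c @^-1` [set t])) * y t|
    <= eta.
Proof.
move=> mD mC muD mg gy.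
pose C t := D `&` c @^-1` [set t].
have mCt t : measurable (C t) := mC t.
have DE : D = \big[setU/set0]_(t <- index_enum I) C t.
  rewrite -bigcup_seq; apply/seteqP; split => [x Dx|x [t _ [] //]].
  by exists (c x) => //=; rewrite mem_index_enum.
have trivC : trivIset [set` index_enum I] C.
  by move=> s t _ _ [x [[_ <-] [_ <-]]].
pose B := \sum_t `|y t| + eta.
have gB x : D x -> `|g x| <= B.
  move=> Dx; have := gy x Dx; rewrite -{2}[g x](subrK (y (c x))).
  move=> h; apply: le_trans (ler_normD _ _) _; rewrite addrC lerD //.
  by rewrite (bigD1 (c x)) //= lerDl sumr_ge0.
have mgC t : measurable_fun (C t) g by apply: measurable_funS mg => // x [].
have iC t : mu.-integrable (C t) (EFin \o g).
  by apply: (@bounded_on_integrable _ _ _ _ _ _ B) => // x [/gB].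
have split_sum (h : X -> R) M : measurable_fun D h ->
    (forall x, D x -> `|h x| <= M) ->
    \int[mu]_(x in D) h x = \sum_t \int[mu]_(x in C t) h x.
  move=> mh hM; rewrite /Rintegral {1}DE integral_bigsetU_EFin //=; last first.
  - by rewrite -DE; exact/measurable_EFinP.
  - exact: index_enum_uniq.
  rewrite -sum_fine // => t _; apply: integrable_fin_num => //.
  apply: (@bounded_on_integrable _ _ _ _ _ _ M) => //.
  - by apply: measurable_funS mh => // x [].
  - by move=> x [/hM].
have one : \sum_t fine (mu (C t)) = 1.
  have n1 x : D x -> `|1 : R| <= 1 by rewrite normr1.
  have := split_sum (fun=> 1) 1 (measurable_cst _) n1.
  rewrite Rintegral_cst // mul1r (_ : fine _ = 1); last exact: (congr1 fine muD).
  by move=> ->; apply: eq_bigr => t _; rewrite Rintegral_cst ?mul1r.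
rewrite (split_sum g B) // -/C -sumrB.
rewrite -[leRHS]mulr1 -one mulr_sumr.
apply: le_trans (ler_norm_sum _ _ _) _; apply: ler_sum => t _.
rewrite mulrC -Rintegral_cst // -RintegralB //; last first.
  by apply: (@bounded_on_integrable _ _ _ _ _ _ `|y t|).
rewrite -Rintegral_cst //.
have iB : mu.-integrable (C t) (EFin \o (fun x => g x - y t)).
  apply: (@bounded_on_integrable _ _ _ _ _ _ eta) => //.
  - exact: measurable_funB.
  - by move=> x [Dx <-]; exact: gy.
apply: le_trans (le_normr_Rintegral _ _) _ => //.
apply: le_Rintegral => //.
- by apply: (integrable_norm iB).
- by apply: (@bounded_on_integrable _ _ _ _ _ _ `|eta|).
- by move=> x [Dx <-]; exact: gy.
Qed.

Lemma compact_coord_bounded (R : realType) (d : nat) (D : set 'rV[R]_d) :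
  compact D ->
  exists2 a : R, 0 < a & forall x i, D x -> `|x ord0 i| <= a.
Proof.
move=> /compact_bounded[M [_ hM]].
exists (`|M| + 1) => [|x i Dx]; first by rewrite ltr_wpDl.
apply: le_trans (hM _ _ _ Dx); last by rewrite (le_lt_trans (ler_norm _)) ?ltrDl.
have -> : `|x| = mx_norm x by [].
rewrite mx_normrE.
exact: (le_bigmax _ (fun ij => `|x ij.1 ij.2|) (ord0, i)).
Qed.

Lemma closed_borel_measurable (R : realType) (d : nat) (D : set 'rV[R]_d) :
  closed D -> measurable (D : set (borel_rV R d)).
Proof.
move=> cD; rewrite -[D]setCK; apply: measurableC.
by apply: sub_sigma_algebra; exact: closed_openC.
Qed.

(** Coordinates are rescaled from [-a, a] to [0, n] and rounded down; the end value n is allowed,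
    whence [n.+1] indices. Within a cell, rescaled coordinates differ by less than 1. *)
Lemma grid_partition (R : realType) (d : nat) (D : set 'rV[R]_d) (a : R)
    (n : nat) :
  0 < a -> (0 < n)%N -> (forall x i, D x -> `|x ord0 i| <= a) ->
  measurable (D : set (borel_rV R d)) ->
  exists c : 'rV[R]_d -> {ffun 'I_d -> 'I_n.+1},
    (forall x y, D x -> D y -> c x = c y -> `|x - y| <= 2 * a / n%:R) /\
    (forall t, measurable (D `&` c @^-1` [set t] : set (borel_rV R d))).
Proof.
move=> a0 n0 Da mD.
have nR : 0 < n%:R :> R by rewrite ltr0n.
pose g (x : 'rV[R]_d) i := (x ord0 i + a) / (2 * a) * n%:R.
have a20 : 0 < 2 * a by rewrite mulr_gt0.
have g0 x i : D x -> 0 <= g x i.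
  move=> Dx; have := Da x i Dx; rewrite ler_norml => /andP[h _].
  by rewrite !mulr_ge0 ?invr_ge0 ?(ltW a20) //; lra.
have gn x i : D x -> g x i <= n%:R.
  move=> Dx; have := Da x i Dx; rewrite ler_norml => /andP[_ h].
  by rewrite -[leRHS]mul1r ler_wpM2r // ler_pdivrMr //; lra.
pose c x : {ffun 'I_d -> 'I_n.+1} := [ffun i => inord (Num.truncn (g x i))].
have cE x i : D x -> (c x i)%:R <= g x i < (c x i).+1%:R.
  move=> Dx; rewrite ffunE inordK ?truncn_itv ?g0 // ltnS.
  rewrite -(ler_nat R); apply: le_trans (gn x i Dx).
  by rewrite truncn_le g0.
exists c; split => [x y Dx Dy cxy|t].
  have -> : `|x - y| = mx_norm (x - y) by [].
  rewrite mx_normrE; apply/bigmax_leP; split.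
    by rewrite divr_ge0 // ltW.
  move=> [i0 i] _ /=; rewrite !mxE ord1.
  have /andP[x1 x2] := cE x i Dx; have /andP[y1 y2] := cE y i Dy.
  rewrite -cxy in y1 y2.
  have -> : x ord0 i - y ord0 i = (g x i - g y i) * (2 * a / n%:R).
    by rewrite /g; field; rewrite !gt_eqF.
  have h0 : 0 < 2 * a / n%:R by rewrite divr_gt0.
  rewrite normrM (gtr0_norm h0) -[leRHS]mul1r ler_wpM2r ?(ltW h0) //.
  by rewrite -natr1 in x2 y2; rewrite ler_norml; lra.
(* Inside [D], a cell is a finite intersection of half-open slabs, obtained from open half-spaces
   and their complements. *)
have -> : D `&` c @^-1` [set t] = D `&` \bigcap_(i in [set: 'I_d])
    (~` [set x : borel_rV R d | g x i < (t i)%:R] `&`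
     [set x : borel_rV R d | g x i < (t i).+1%:R]).
  apply/seteqP; split => x [Dx].
    move=> /= <-; split => // i _; have /andP[h1 h2] := cE x i Dx.
    by split => //=; apply/negP; rewrite -leNgt.
  move=> h; split => //=; apply/ffunP => i; have [/negP h1 h2] := h i I.
  rewrite -leNgt in h1.
  by apply/val_inj; rewrite ffunE /= (@truncn_def _ _ (t i)) ?h1 // inord_val.
apply: measurableI => //; apply: fin_bigcap_measurable => // i _.
have mg (r : R) : measurable [set x : borel_rV R d | g x i < r].
  apply: sub_sigma_algebra.
  apply: (@open_comp _ _ (fun x : 'rV[R]_d => g x i) [set y | y < r]);
    last exact: open_lt.
  move=> x _; rewrite /g.
  apply: (@continuousM _ _ (fun y : 'rV[R]_d => (y ord0 i + a) / (2 * a)));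
    last exact: cst_continuous.
  apply: (@continuousM _ _ (fun y : 'rV[R]_d => y ord0 i + a));
    last exact: cst_continuous.
  apply: (@continuousD _ _ _ (fun y : 'rV[R]_d => y ord0 i));
    last exact: cst_continuous.
  exact: coord_continuous.
by apply: measurableI => //; apply: measurableC.
Qed.

(** * Choice of the parameters *)

(** The grid must be fine enough for the Gram error, yet polynomial in [N], so that the logarithm of
    the number of cells is O(ln N). *)
Lemma grid_resolution (R : realType) (a K kap alpha beta : R) (d : nat) :
  0 < a -> 0 <= K -> 1 <= kap -> 0 < alpha ->
  exists2 C : R, 0 <= C & forall N : nat, (2 <= N)%N ->
    exists n : nat, [/\ (0 < n)%N,
      256 * N%:R ^+ 2 * kap ^+ 3 *
        (K * N%:R `^ beta * (2 * a / n%:R) `^ alpha) <= 1 &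
      ln (2 * (n.+1 ^ d)%:R) <= C * ln N%:R].
Proof.
move=> a0 K0 kap1 al0.
have kap0 : 0 < kap by apply: lt_le_trans kap1.
(* [K + 1] keeps [P] positive, and [beta] is replaced by its absolute value to keep [gam]
   nonnegative. Solving (2a/n)^alpha <= 1 / (P N^(|beta| + 2)) for n gives n >= D N^gam. *)
pose P := 256 * kap ^+ 3 * (K + 1).
have P0 : 0 < P by rewrite !mulr_gt0 ?ltr0n ?exprn_gt0 ?ltr_wpDl.
pose gam := (`|beta| + 2) / alpha.
have gam0 : 0 <= gam by rewrite divr_ge0 ?addr_ge0 // ltW.
pose D := 2 * a * P `^ alpha^-1.
have D0 : 0 < D by rewrite !mulr_gt0 ?powR_gt0.
have ln20 : 0 < ln (2 : R) by rewrite ln_gt0 // ltr1n.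
have lnD : 0 <= ln (D + 2) by rewrite ln_ge0 //; lra.
(* The 1 pays for ln 2 <= ln N. The rest comes from n + 1 <= (D + 2) N^gam, constants being turned
   into multiples of ln N through N >= 2. *)
exists (1 + d%:R * (ln (D + 2) / ln 2 + gam)).
  by rewrite addr_ge0 // mulr_ge0 // addr_ge0 // divr_ge0 // ltW.
move=> N N2.
have N0 : 0 < N%:R :> R by rewrite ltr0n (leq_trans _ N2).
have N1 : 1 <= N%:R :> R by rewrite ler1n (leq_trans _ N2).
have lnN : ln 2 <= ln N%:R :> R by rewrite ler_ln ?posrE // ler_nat.
pose X := D * N%:R `^ gam.
have X0 : 0 < X by rewrite mulr_gt0 ?powR_gt0.
exists (Num.truncn X).+1; split => //.
  have h : (2 * a / (Num.truncn X).+1%:R) `^ alpha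
      <= (P * N%:R `^ (`|beta| + 2))^-1.
    have -> : (P * N%:R `^ (`|beta| + 2))^-1 = (2 * a / X) `^ alpha.
      have -> : 2 * a / X = (P `^ alpha^-1 * N%:R `^ gam)^-1.
        by rewrite /X /D; field; rewrite !gt_eqF ?powR_gt0.
      set Q := (X in (_ = X^-1 `^ _)).
      have Q0 : 0 <= Q by rewrite mulr_ge0 ?powR_ge0.
      rewrite -(powR_inv1 Q0) -powRrM mulN1r powRN; congr (_^-1).
      rewrite powRM ?powR_ge0 // -!powRrM mulVf ?gt_eqF // powRr1 ?ltW //.
      by rewrite divfK ?gt_eqF.
    apply: ge0_ler_powR; rewrite ?nnegrE ?divr_ge0 ?mulr_ge0 ?powR_ge0
      ?(ltW a0) ?(ltW X0) ?(ltW al0) //.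
    rewrite ler_pM2l ?mulr_gt0 // lef_pV2 ?posrE ?ltr0n //.
    exact/ltW/truncnS_gt.
  have Nb : N%:R `^ (`|beta| + 2) = N%:R `^ `|beta| * N%:R ^+ 2.
    by rewrite powRD ?gt_eqF ?implybT // powR_mulrn ?ltW.
  have hb : N%:R `^ beta <= N%:R `^ `|beta| by rewrite ler_powR ?ler_norm.
  set y := (_ `^ alpha) in h *.
  have y0 : 0 <= y by exact: powR_ge0.
  apply: (@le_trans _ _ (P * N%:R `^ (`|beta| + 2) * y)); last first.
    have Q0 : 0 < P * N%:R `^ (`|beta| + 2) by rewrite mulr_gt0 ?powR_gt0.
    by rewrite -[leRHS](mulfV (lt0r_neq0 Q0)) ler_pM2l.
  rewrite Nb /P.
  have -> : 256 * N%:R ^+ 2 * kap ^+ 3 * (K * N%:R `^ beta * y) =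
    256 * kap ^+ 3 * N%:R ^+ 2 * y * (K * N%:R `^ beta) by ring.
  have -> : 256 * kap ^+ 3 * (K + 1) * (N%:R `^ `|beta| * N%:R ^+ 2) * y =
    256 * kap ^+ 3 * N%:R ^+ 2 * y * ((K + 1) * N%:R `^ `|beta|) by ring.
  apply: ler_wpM2l; first by rewrite !mulr_ge0 ?ler0n ?exprn_ge0 // ltW.
  by apply: ler_pM; rewrite ?powR_ge0 // lerDl.
have n0 : 0 < (Num.truncn X).+2%:R :> R by rewrite ltr0n.
rewrite lnM ?posrE ?ltr0n ?expn_gt0 // natrX lnXn // -[X in _ + X]mulr_natl.
have lnn : ln (Num.truncn X).+2%:R <= ln (D + 2) + gam * ln N%:R.
  rewrite -ln_powR -lnM ?posrE ?powR_gt0 //; last by lra.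
  rewrite ler_ln ?posrE ?mulr_gt0 ?powR_gt0 //; last by lra.
  have : (Num.truncn X)%:R <= X by rewrite truncn_le ltW.
  have : 1 <= N%:R `^ gam.
    by rewrite -[leLHS](powRr0 N%:R) ler_powR.
  rewrite -addn2 natrD /X; nra.
have : d%:R * ln (Num.truncn X).+2%:R <= d%:R * (ln (D + 2) + gam * ln N%:R).
  by rewrite ler_wpM2l.
have : ln (D + 2) <= ln (D + 2) / ln 2 * ln N%:R.
  by rewrite -mulrA ler_peMr // ler_pdivlMl // mulr1.
move=> h1.
have : d%:R * ln (D + 2) <= d%:R * (ln (D + 2) / ln 2 * ln N%:R).
  by rewrite ler_wpM2l.
lra.
Qed.

(** Rounding up adds at most 1 <= N ln N / ln 2, and the factor (ln N / ln 2)^(5/2) >= 1 raises the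
    power of the logarithm to 7/2. *)
Lemma sample_size (R : realType) (B : R) :
  0 <= B ->
  exists C : R, forall N : nat, (2 <= N)%N -> exists m : nat,
    [/\ (0 < m)%N, B * N%:R * ln N%:R <= m%:R &
        m%:R <= C * N%:R * ln N%:R `^ (7 / 2)].
Proof.
move=> B0.
have ln20 : 0 < ln (2 : R) by rewrite ln_gt0 // ltr1n.
exists ((B + (ln 2)^-1) * (ln 2 `^ (5 / 2))^-1) => N N2.
have N1 : 1 <= N%:R :> R by rewrite ler1n (leq_trans _ N2).
have lnN : ln 2 <= ln N%:R :> R.
  by rewrite ler_ln ?posrE ?ler_nat // (lt_le_trans _ N1).
have lnN0 : 0 < ln N%:R :> R by apply: lt_le_trans lnN.
have Y0 : 0 <= B * N%:R * ln N%:R by rewrite !mulr_ge0 // ltW.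
exists (Num.truncn (B * N%:R * ln N%:R)).+1; split => //.
  exact/ltW/truncnS_gt.
have h1 : (Num.truncn (B * N%:R * ln N%:R))%:R <= B * N%:R * ln N%:R.
  by rewrite truncn_le.
have h2 : 1 <= (ln (2 : R))^-1 * N%:R * ln N%:R.
  by rewrite mulrAC mulr_ege1 // ler_pdivlMl // mulr1.
have -> : ln N%:R `^ (7 / 2) = ln N%:R `^ (5 / 2) * ln N%:R :> R.
  rewrite -[X in _ = _ * X]powRr1 ?(ltW lnN0) // -powRD ?(gt_eqF lnN0) ?implybT //.
  by congr (_ `^ _); field.
have h3 : 1 <= (ln 2 `^ (5 / 2))^-1 * ln N%:R `^ (5 / 2) :> R.
  rewrite ler_pdivlMl ?powR_gt0 // mulr1.
  by apply: ge0_ler_powR; rewrite ?nnegrE // ?ltW // divr_ge0.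
have -> : (B + (ln (2:R))^-1) * (ln 2 `^ (5 / 2))^-1 * N%:R *
    (ln N%:R `^ (5 / 2) * ln N%:R) =
  (B * N%:R * ln N%:R + (ln 2)^-1 * N%:R * ln N%:R) *
  ((ln 2 `^ (5 / 2))^-1 * ln N%:R `^ (5 / 2)) by ring.
apply: (@le_trans _ _ (B * N%:R * ln N%:R + (ln 2)^-1 * N%:R * ln N%:R)).
  by rewrite -natr1 lerD.
by rewrite ler_peMr //; lra.
Qed.

(** * Transfer between the grid and the compact set *)

Theorem theorem1p1 (R : realType) (d : nat) (Omega : set 'rV[R]_d)
    (K1 K2 K3 K4 alpha beta : R) :
  compact Omega -> 0 < alpha ->
  exists C1 : R,
  forall (mu : probability (borel_rV R d) R) (N : nat)
    (u : 'I_N -> 'rV[R]_d -> R),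
    mu Omega = 1%E ->
    (2 <= N)%N ->
    orthonormal_system mu Omega u ->
    (* (A) *)
    (forall i x y, Omega x -> Omega y ->
       `|u i x - u i y| <= K1 * N%:R `^ beta * `|x - y| `^ alpha) ->
    (* (B) *)
    (forall i, (supnorm Omega (u i) ^+ 2 <= K2%:E)%E) ->
    (* (C) *)
    (forall f (p : R), span_on Omega u f -> 2 <= p ->
       (supnorm Omega f <=
          (K3 * N%:R `^ (K4 / p))%:E * lpnorm mu Omega p f)%E) ->
    exists (m : nat) (xi : 'I_m -> 'rV[R]_d),
      [/\ (0 < m)%N,
          m%:R <= C1 * N%:R * ln N%:R `^ (7 / 2),
          (forall j, Omega (xi j)) &
          forall f, span_on Omega u f ->
            ((1 / 2)%:E * lpnorm mu Omega 1 f
               <= (m%:R^-1 * \sum_(j < m) `|f (xi j)|)%:E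
             /\ (m%:R^-1 * \sum_(j < m) `|f (xi j)|)%:E
               <= (3 / 2)%:E * lpnorm mu Omega 1 f)%E].

Proof.
move=> cO al0.
have [a a0 aO] := compact_coord_bounded _ _ _ cO.
pose kap : R := Num.max 1 (Num.sqrt K2).
have kap1 : 1 <= kap by rewrite le_max lexx.
have kap0 : 0 < kap by apply: lt_le_trans kap1.
have [C C0 hC] := grid_resolution R a `|K1| kap alpha beta d a0 (normr_ge0 _) kap1 al0.
(* The requirement of [equal_weight_sampling], with the logarithm of the cell count bounded by
   [C * ln N]. All constants are fixed before [mu], [N] and [u]. *)
have [|C1 hC1] := sample_size R (16384 * kap ^+ 2 * C).
  by apply: mulr_ge0 C0; apply: mulr_ge0; [exact: ler0n|exact: sqr_ge0].
exists C1 => mu N u muO N2 [mu_meas orth] hA hB _.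
have [n [n0 res lnT]] := hC N N2.
have [m [m0 mlow mup]] := hC1 N N2.
have mO : measurable (Omega : set (borel_rV R d)).
  by apply: closed_borel_measurable; apply: compact_closed cO.
have [x0 Ox0] : exists x, Omega x.
  apply/set0P/eqP => O0; move: muO; rewrite O0 measure0 => /eqP.
  by rewrite eqe eq_sym oner_eq0.
have [c [c_diam c_meas]] := grid_partition R d Omega a n a0 n0 aO mO.
(* A cell that misses [Omega] gets the default [x0], so that every representative lies in
   [Omega]. *)
have /choice[rep hrep] : forall t, exists x, Omega x /\
    forall y, Omega y -> c y = t -> c x = t.
  move=> t; have [[y [Oy cy]]|no] := pselect (exists y, Omega y /\ c y = t).
    by exists y.
  by exists x0; split => // y Oy cy; case: no; exists y.
have Orep t : Omega (rep t) by case: (hrep t).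
have N0 : 0 < N%:R :> R by rewrite ltr0n (leq_trans _ N2).
have N1 : 1 <= N%:R :> R by rewrite ler1n (leq_trans _ N2).
have u_le i x : Omega x -> `|u i x| <= kap.
  move=> Ox; rewrite le_max; apply/orP; right.
  have h : ((`|u i x| ^+ 2)%:E <= K2%:E)%E.
    apply: le_trans (hB i); rewrite EFin_expe !expe2.
    have h0 : (`|u i x|%:E <= supnorm Omega (u i))%E.
      by apply: ereal_sup_ubound; exists x.
    by apply: lee_pmul; rewrite ?lee_fin.
  rewrite lee_fin in h.
  by rewrite -[leLHS]ger0_norm // -sqrtr_sqr ler_wsqrtr.
pose osc := `|K1| * N%:R `^ beta * (2 * a / n%:R) `^ alpha.
have osc0 : 0 <= osc by rewrite !mulr_ge0 ?powR_ge0.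
have u_osc i x : Omega x -> `|u i x - u i (rep (c x))| <= osc.
  move=> Ox; have [_ /(_ x Ox erefl) crep] := hrep (c x).
  apply: le_trans (hA i _ _ Ox (Orep _)) _.
  apply: (@le_trans _ _ (`|K1| * N%:R `^ beta * `|x - rep (c x)| `^ alpha)).
    by rewrite ler_wpM2r ?powR_ge0 // ler_wpM2r ?powR_ge0 // ler_norm.
  rewrite ler_wpM2l ?mulr_ge0 ?powR_ge0 //.
  apply: ge0_ler_powR; rewrite ?nnegrE ?divr_ge0 ?mulr_ge0 ?(ltW a0) ?(ltW al0) //.
  exact: c_diam.
pose w t := fine (mu (Omega `&` c @^-1` [set t])).
pose U i t := u i (rep t).
have w0 t : 0 <= w t by exact: fine_ge0.
have w1 : \sum_t w t = 1.
  have h x : Omega x -> `|1 - 1 : R| <= 0 by rewrite subrr normr0.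
  have := Rintegral_quantization _ _ _ mu Omega _ c (fun=> 1) (fun=> 1) 0
    mO c_meas muO (measurable_cst _) h.
  rewrite Rintegral_cst // mul1r (_ : fine _ = 1); last exact: (congr1 fine muO).
  rewrite normr_le0 subr_eq0 => /eqP ->.
  by apply: eq_bigr => t _; rewrite mulr1.
have Uk i t : `|U i t| <= kap by apply: u_le.
(* Each of the two factors of a product moves by at most [osc] while the other is bounded by [kap];
   the integral itself is exact by orthonormality. *)
have gram i k : `|\sum_t w t * (U i t * U k t) - (i == k)%:R| <= 2 * kap * osc.
  have h x : Omega x -> `|u i x * u k x - U i (c x) * U k (c x)| <= 2 * kap * osc.
    move=> Ox.
    have -> : u i x * u k x - U i (c x) * U k (c x) =
      u i x * (u k x - U k (c x)) + U k (c x) * (u i x - U i (c x)) by ring.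
    apply: le_trans (ler_normD _ _) _; rewrite !normrM.
    have -> : 2 * kap * osc = kap * osc + kap * osc by ring.
    by apply: lerD; apply: ler_pM => //; [exact: u_le|exact: u_osc|exact: u_osc].
  rewrite distrC.
  have := Rintegral_quantization _ _ _ mu Omega _ c (fun x => u i x * u k x)
    (fun t => U i t * U k t) _ mO c_meas muO
    (measurable_funM (mu_meas i) (mu_meas k)) h.
  by rewrite /Rintegral (_ : (\int[mu]_(x in _) _)%E = ((i == k)%:R : R)%:E).
have small : 128 * N%:R ^+ 2 * kap ^+ 2 * (2 * kap * osc) <= 1.
  by apply: le_trans res; rewrite le_eqVlt -/osc; apply/orP; left; apply/eqP; ring.
have osc_small : 128 * (2 * N%:R * kap * osc) <= 1.
  apply: le_trans small.
  have -> : 128 * N%:R ^+ 2 * kap ^+ 2 * (2 * kap * osc) =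
    128 * (2 * N%:R * kap * osc) * (N%:R * kap ^+ 2) by ring.
  apply: ler_peMr; last by rewrite mulr_ege1 // exprn_ege1.
  apply: mulr_ge0 => //; apply: mulr_ge0 osc0; apply: mulr_ge0 (ltW kap0).
  exact: mulr_ge0.
have Npos : (0 < N)%N by rewrite (leq_trans _ N2).
have [||xi hxi] := equal_weight_sampling w U kap _ w0 w1 Npos kap1 Uk gram small m.
- by [].
- apply: le_trans mlow; rewrite card_ffun !card_ord.
  have -> : 16384 * kap ^+ 2 * C * N%:R * ln N%:R =
    16384 * N%:R * kap ^+ 2 * (C * ln N%:R) by ring.
  apply: ler_wpM2l lnT.
  by apply: mulr_ge0 (sqr_ge0 _); apply: mulr_ge0; exact: ler0n.
exists m, (fun j => rep (xi j)); split => // f [b fb].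
(* [f] agrees with this combination on [Omega] only; all sampled representatives lie there. *)
pose F x := \sum_(i < N) b i * u i x.
have mF : measurable_fun (Omega : set (borel_rV R d)) (fun x => `|F x|).
  apply: measurableT_comp => //; apply: measurable_sum => i.
  exact: measurable_funM.
have Fb x : Omega x -> `|(`|F x|)| <= \sum_i `|b i| * kap.
  move=> Ox; rewrite normr_id; apply: le_trans (ler_norm_sum _ _ _) _.
  by apply: ler_sum => i _; rewrite normrM ler_wpM2l //; exact: u_le.
pose L := \int[mu]_(x in Omega) `|F x|.
have lpE : lpnorm mu Omega 1 f = L%:E.
  rewrite /lpnorm Lnorm1 /L /Rintegral fineK; last first.
    apply: integrable_fin_num => //.
    exact: (bounded_on_integrable _ _ _ _ _ _ _ mO mF Fb).
  rewrite [RHS]integral_mkcond; apply: eq_integral => x _ /=.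
  rewrite /patch; case: ifPn => [|_]; last by rewrite normr0.
  by rewrite inE => Ox; rewrite fb.
pose W := \sum_t w t * `|F (rep t)|.
have LW : `|L - W| <= osc * \sum_i `|b i|.
  apply: (Rintegral_quantization _ _ _ mu Omega _ c _ (fun t => `|F (rep t)|)) => //.
  move=> x Ox; apply: le_trans (ler_dist_dist _ _) _.
  rewrite /F -sumrB mulr_sumr; apply: le_trans (ler_norm_sum _ _ _) _.
  apply: ler_sum => i _; rewrite -mulrBr normrM mulrC ler_wpM2r //.
  exact: u_osc.
have bW : \sum_i `|b i| <= 2 * N%:R * kap * W.
  exact: (coefficients_le_l1 w U kap _ w0 Npos kap1 Uk gram small b).
have W0 : 0 <= W by apply: sumr_ge0 => t _; rewrite mulr_ge0.
(* The grid norm [W] is within 1/128 of itself from [L], and the sample mean within 1/4; together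
   these fit in the factors 1/2 and 3/2. *)
have LW' : `|L - W| <= W / 128.
  apply: le_trans LW _; apply: (@le_trans _ _ (osc * (2 * N%:R * kap * W))).
    by rewrite ler_wpM2l.
  have : 128 * (2 * N%:R * kap * osc) * W <= 1 * W by rewrite ler_wpM2r.
  by clear; lra.
have mR : 0 < m%:R :> R by rewrite ltr0n.
have SW := hxi b.
rewrite lpE -!EFinM !lee_fin.
have -> : \sum_(j < m) `|f (rep (xi j))| = \sum_(j < m) `|F (rep (xi j))|.
  by apply: eq_bigr => j _; rewrite fb.
set S := \sum_(j < m) `|F (rep (xi j))|.
have {}SW : `|S - m%:R * W| <= m%:R / 4 * W by exact: SW.
have mLW : m%:R * `|L - W| <= m%:R * (W / 128) by rewrite ler_pM2l.
have mLW' : m%:R * `|L - W| = `|m%:R * L - m%:R * W|.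
  by rewrite -mulrBr normrM (gtr0_norm mR).
have mW0 : 0 <= m%:R * W by rewrite mulr_ge0.
move: SW mLW mW0; rewrite mLW' !ler_norml; clear - mR.
by move=> /andP[? ?] /andP[? ?] ?;
  split; [rewrite ler_pdivlMl|rewrite ler_pdivrMl] => //; lra.
Qed.
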